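(* The NGEV equilibrium assignment is equivalent to the following system of non-linear equations. [NLE-C] Find $\mathbf c^*\in\mathcal C$ such that $\mathbf C^{-1}(\mathbf c^* )=\mathbf F(\mathbf c^* )$.
   Context: Network. $G=(\mathcal N,\mathcal L)$ is a finite directed time-space network; $\mathcal L=\mathcal L_T\cup\mathcal L_A\cup\mathcal L_B\cup\mathcal L_Q$ is partitioned into time-space (driving), access/egress/transfer, on-board and boarding-queue links. $\Psi$ is the set of run-station pairs $(r,s)$, and $\mathcal L_Q$ is the disjoint union of sets $\mathcal L_Q^{(r,s)}$, $(r,s)\in\Psi$, each consisting of links numbered $l=1,\dots,N$. For each $(r,s)$ there is a sequence of on-board nodes $1,\dots,N$; the $l$-th boarding-queue link (flow $z_l^{(r,s)}$) enters the $l$-th on-board node, the $l$-th on-board link (flow $x_l^{(r,s)}$) leaves it, and $x_0^{(r,s)}$ is the flow on the link of run $r$ entering the first on-board node; flow conservation gives $x_l^{(r,s)}=x_{l-1}^{(r,s)}+z_l^{(r,s)}=x_0^{(r,s)}+\sum_{k=1}^l z_k^{(r,s)}$. Costs. The vector link cost function $\mathbf C$ maps aggregated link flows $\mathbf x\in\mathbb R_+^{|\mathcal L|}$ to link costs as follows. The cost of each link $ij\in\mathcal L_T\cup\mathcal L_A\cup\mathcal L_B$ is a continuous, differentiable, strictly increasing function of its own flow $x_{ij}$. On-board links of run $r$ have capacity $\mu^{(r)}$, and the cost of the $l$-th boarding-queue link of $(r,s)$ is $f_l\big(x_0^{(r,s)}+\sum_{k=1}^l z_k^{(r,s)}\mid\mu^{(r)}\big)$,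 where $f_l(\cdot\mid\mu)$ is continuous, differentiable and strictly increasing with $\lim_{x\to\mu}f_l(x\mid\mu)=+\infty$ (value $+\infty$ for $x\ge\mu$). Costs are nonnegative. $Y$ (supply-feasible flows) is the set of $\mathbf x\in\mathbb R_+^{|\mathcal L|}$ with $\mathbf C(\mathbf x)$ finite; $\mathcal C=\{\mathbf C(\mathbf x):\mathbf x\in Y\}$; $\mathbf C:Y\to\mathcal C$ is one-to-one with inverse $\mathbf C^{-1}:\mathcal C\to Y$. Demand. $\mathcal D$ is the set of destinations; $\mathbf q_d=(q_i^d)_{i\in\mathcal N}$ is the given demand to $d$, with $q_i^d>0$ when $(i,d)$ is an origin-destination pair and $q_i^d=0$ otherwise. $\mathcal F(i)$ and $\mathcal B(i)$ are the sets of successor and predecessor nodes of $i$. $X_d$ is the set of $\mathbf x_d=(x^d_{ij})_{ij\in\mathcal L}\ge\mathbf 0$ with $\sum_{n\in\mathcal F(i)}x_{in}^d-\sum_{n\in\mathcal B(i)}x_{ni}^d=q_i^d$ for all $i\in\mathcal N\setminus\{d\}$. $\hat X=\prod_{d\in\mathcal D}X_d$, with elements $\hat{\mathbf x}=(\mathbf x_d)_{d\in\mathcal D}$; $X=\{\sum_d\mathbf x_d:\hat{\mathbf x}\in\hat X\}$. NGEV equilibrium assignment. Parameters: $\theta_i^d>0$ and $\alpha_{ji}^d\ge0$ with $\sum_{i\in\mathcal B(j)}\alpha_{ji}^d=1$. The problem is to find link costs $\mathbf c=(c_{ij})$, flows $\hat{\mathbf x}\in\hat X$ with $\mathbf x=\sum_d\mathbf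 x_d\in X\cap Y$, and expected minimum costs $(s_{id})_{i\in\mathcal N,d\in\mathcal D}$ (with $s_{dd}=0$) such that $\mathbf c=\mathbf C(\mathbf x)$ and, for all $d\in\mathcal D$, all $i\in\mathcal N\setminus\{d\}$ and all links $ij$, $$p^d_{ij|i}=\frac{\alpha^d_{ji}e^{-\theta^d_i(c_{ij}+s_{jd})}}{\sum_{n\in\mathcal F(i)}\alpha^d_{ni}e^{-\theta^d_i(c_{in}+s_{nd})}},\quad 1=\sum_{n\in\mathcal F(i)}\alpha^d_{ni}e^{-\theta^d_i(c_{in}+s_{nd}-s_{id})},\quad x^d_{ij}=p^d_{ij|i}\sum_{n\in\mathcal F(i)}x^d_{in}.$$ Demand function. With the convention $0\ln0=0$, $$H_d(\mathbf x_d)=-\sum_{i\in\mathcal N}\frac1{\theta_i^d}\sum_{j\in\mathcal F(i)}x_{ij}^d\Big[\ln\frac{x_{ij}^d}{\sum_{n\in\mathcal F(i)}x_{in}^d}-\ln\alpha_{ji}^d\Big];$$ for $\mathbf c\in\mathcal C$, $\mathbf F_d(\mathbf c)$ is the unique minimizer of $\mathbf c\cdot\mathbf x_d-H_d(\mathbf x_d)$ over $\mathbf x_d\in X_d$, and $\mathbf F(\mathbf c)=\sum_{d\in\mathcal D}\mathbf F_d(\mathbf c)$. Equivalence means that $\mathbf c^*$ is the cost component of a solution of the NGEV equilibrium assignment if and only if it solves [NLE-C].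
   Formalization: The time-space network is taken acyclic; weights α into j sum to 1 only if j has predecessors; each OD pair is joined by links with α>0; where no such route to d exists, s_id=+∞, p=0 and the equation 1=Σ is dropped (literally it reads 1=0 at other sinks). *)

(* Defs.v *)
From HB Require Import structures.
From mathcomp Require Import all_boot all_order all_algebra.
From mathcomp Require Import all_classical all_reals all_analysis.

Set Implicit Arguments.
Unset Strict Implicit.
Unset Printing Implicit Defensive.

Import Order.TTheory GRing.Theory Num.Theory.
Import numFieldNormedType.Exports.

Local Open Scope classical_set_scope.
Local Open Scope ring_scope.

Inductive link_kind := Driving | AccessEgressTransfer | OnBoard | BoardingQueue.

(* A link ij is determined by its end nodes, so sums over the successors
   (predecessors) of i are written as sums over the links with tail (head) i.
   Time only moves forward along the links of a time-space network, hence it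
   has no directed cycle. *)
Record network := Network {
  node : finType;
  link : finType;
  tail : link -> node;
  head : link -> node;
  kind : link -> link_kind;
  link_simple : injective (fun e => (tail e, head e));
  link_acyclic : forall p : seq node,
    cycle [rel i j | [exists e, (tail e == i) && (head e == j)]] p -> p = [::]
}.

Definition flow (R : realType) (G : network) := link G -> R.

(* For a run-station pair p = (r, s) and 1 <= l <= nqueue, [queue p l] and
   [onboard p l] are the l-th boarding-queue and on-board links (with flows z_l
   and x_l), and [onboard p 0] is the link of run r entering the first on-board
   node (with flow x_0). Values at other indices are irrelevant. *)
Record boarding (G : network) := Boarding {
  run : finType;
  station : finType;
  run_station : {set run * station};
  nqueue : nat;
  onboard_node : run * station -> nat -> node G;
  queue : run * station -> nat -> link G;
  onboard : run * station -> nat -> link G;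
  nqueue_gt0 : (0 < nqueue)%N;
  queueP : forall e, kind e = BoardingQueue <->
    exists p l, [/\ p \in run_station, (0 < l <= nqueue)%N & e = queue p l];
  queue_inj : forall p l p' l', p \in run_station -> p' \in run_station ->
    (0 < l <= nqueue)%N -> (0 < l' <= nqueue)%N ->
    queue p l = queue p' l' -> p = p' /\ l = l';
  onboard_kind : forall p l, p \in run_station -> (0 < l <= nqueue)%N ->
    kind (onboard p l) = OnBoard;
  entry_kind : forall p, p \in run_station ->
    kind (onboard p 0) = Driving \/ kind (onboard p 0) = OnBoard;
  onboard_node_in : forall p l, p \in run_station -> (0 < l <= nqueue)%N ->
    forall e, head e = onboard_node p l <-> e = onboard p l.-1 \/ e = queue p l;
  onboard_node_out : forall p l, p \in run_station -> (0 < l <= nqueue)%N ->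
    forall e, tail e = onboard_node p l <-> e = onboard p l
}.

Record link_costs (R : realType) (G : network) (B : boarding G) := LinkCosts {
  capacity : run B -> R;
  own_cost : link G -> R -> R;
  queue_cost : nat -> R -> R -> \bar R;
  cost : flow R G -> link G -> \bar R;
  own_cost_continuous : forall e, kind e <> BoardingQueue ->
    {within `[0, +oo[, continuous (own_cost e)};
  own_cost_derivable : forall e, kind e <> BoardingQueue ->
    {in `]0, +oo[, forall x, derivable (own_cost e) x 1};
  own_cost_increasing : forall e, kind e <> BoardingQueue ->
    {in `[0, +oo[ &, {homo own_cost e : x y / x < y}};
  queue_cost_fin : forall r l, (0 < l <= nqueue B)%N ->
    forall x, 0 <= x -> x < capacity r ->
    queue_cost l (capacity r) x \is a fin_num;
  queue_cost_pinfty : forall r l, (0 < l <= nqueue B)%N ->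
    forall x, capacity r <= x -> queue_cost l (capacity r) x = +oo%E;
  queue_cost_cvg : forall r l, (0 < l <= nqueue B)%N ->
    queue_cost l (capacity r) x @[x --> capacity r] --> +oo%E;
  queue_cost_continuous : forall r l, (0 < l <= nqueue B)%N ->
    {within `[0, capacity r[, continuous (fine \o queue_cost l (capacity r))};
  queue_cost_derivable : forall r l, (0 < l <= nqueue B)%N ->
    {in `]0, capacity r[, forall x,
      derivable (fine \o queue_cost l (capacity r)) x 1};
  queue_cost_increasing : forall r l, (0 < l <= nqueue B)%N ->
    {in `[0, capacity r[ &, {homo queue_cost l (capacity r) : x y / (x < y)%R
                                                             >-> (x < y)%E}};
  cost_own : forall x, (forall e, 0 <= x e) ->
    forall e, kind e <> BoardingQueue -> cost x e = (own_cost e (x e))%:E;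
  cost_queue : forall x, (forall e, 0 <= x e) ->
    forall p l, p \in run_station B -> (0 < l <= nqueue B)%N ->
    cost x (queue p l) =
      queue_cost l (capacity p.1)
        (x (onboard p 0) + \sum_(1 <= k < l.+1) x (queue p k));
  cost_ge0 : forall x, (forall e, 0 <= x e) -> forall e, (0 <= cost x e)%E
}.

(* Links of weight 0 are never used, so they do not count for connectivity. *)
Definition has_route (R : realType) (G : network) (w : link G -> R)
    (i j : node G) : bool :=
  connect [rel i j | [exists e, [&& tail e == i, head e == j & 0 < w e]]] i j.

(* [theta d i] is theta_i^d and, for a link e = ij, [alpha d e] is alpha_{ji}^d.
   The weights alpha into j sum to 1 whenever j has a predecessor (an acyclic
   network has nodes without any). *)
Record demand (R : realType) (G : network) (B : boarding G) := Demand {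
  dest : {set node G};
  od : {set node G * node G};
  od_demand : node G -> node G -> R;
  theta : node G -> node G -> R;
  alpha : node G -> link G -> R;
  od_dest : forall i d, (i, d) \in od -> d \in dest;
  od_demand_gt0 : forall i d, (i, d) \in od -> 0 < od_demand d i;
  od_demand_eq0 : forall i d, (i, d) \notin od -> od_demand d i = 0;
  theta_gt0 : forall d i, d \in dest -> 0 < theta d i;
  alpha_ge0 : forall d e, d \in dest -> 0 <= alpha d e;
  alpha_sum : forall d e0, d \in dest ->
    \sum_(e | head e == head e0) alpha d e = 1;
  od_connected : forall i d, (i, d) \in od -> has_route (alpha d) i d;
  onboard_node_dest : forall p l, p \in run_station B ->
    (0 < l <= nqueue B)%N -> onboard_node p l \notin dest;
  onboard_node_od : forall p l d, p \in run_station B ->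
    (0 < l <= nqueue B)%N -> (onboard_node p l, d) \notin od
}.

Definition supply_feasible (R : realType) (G : network) (B : boarding G)
    (S : link_costs R B) : set (flow R G) :=
  [set x | (forall e, 0 <= x e) /\ (forall e, cost S x e \is a fin_num)].

Definition cost_map (R : realType) (G : network) (B : boarding G)
    (S : link_costs R B) (x : flow R G) : flow R G :=
  fun e => fine (cost S x e).

Definition cost_set (R : realType) (G : network) (B : boarding G)
    (S : link_costs R B) : set (flow R G) :=
  cost_map S @` supply_feasible S.

Definition cost_inv (R : realType) (G : network) (B : boarding G)
    (S : link_costs R B) : flow R G -> flow R G :=
  'pinv_(fun=> (fun=> 0)) (supply_feasible S) (cost_map S).

Definition outflow (R : realType) (G : network) (x : flow R G) (i : node G) : R :=
  \sum_(e | tail e == i) x e.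

Definition inflow (R : realType) (G : network) (x : flow R G) (i : node G) : R :=
  \sum_(e | head e == i) x e.

Definition demand_feasible (R : realType) (G : network) (B : boarding G)
    (M : demand R B) (d : node G) : set (flow R G) :=
  [set x | (forall e, 0 <= x e) /\
           (forall i, i != d -> outflow x i - inflow x i = od_demand M d i)].

Definition total_flow (R : realType) (G : network) (B : boarding G)
    (M : demand R B) (xhat : node G -> flow R G) : flow R G :=
  fun e => \sum_(d in dest M) xhat d e.

Definition reaches (R : realType) (G : network) (B : boarding G)
    (M : demand R B) (d i : node G) : bool :=
  has_route (alpha M d) i d.

(* Extended-real because ln 0 = -oo: in \bar R one has 0 * -oo = 0, which is the
   convention 0 ln 0 = 0 (also when alpha = 0), and a positive flow on a link
   with alpha = 0 makes H_d equal to -oo. *)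
Definition entropy (R : realType) (G : network) (B : boarding G)
    (M : demand R B) (d : node G) (x : flow R G) : \bar R :=
  (- \sum_(i : node G) ((theta M d i)^-1)%:E *
       \sum_(e | tail e == i)
          (x e)%:E * (lne (x e / outflow x i)%:E - lne (alpha M d e)%:E))%E.

Definition assignment_objective (R : realType) (G : network) (B : boarding G)
    (M : demand R B) (c : flow R G) (d : node G) (x : flow R G) : \bar R :=
  ((\sum_e c e * x e)%:E - entropy M d x)%E.

Definition assignment_argmin (R : realType) (G : network) (B : boarding G)
    (M : demand R B) (c : flow R G) (d : node G) : set (flow R G) :=
  [set x | demand_feasible M d x /\
           forall y, demand_feasible M d y ->
             (assignment_objective M c d x <= assignment_objective M c d y)%E].

(* The choice operator picks the unique minimizer. *)
Definition demand_fun_dest (R : realType) (G : network) (B : boarding G)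
    (M : demand R B) (d : node G) (c : flow R G) : flow R G :=
  xget (fun=> 0) (assignment_argmin M c d).

Definition demand_fun (R : realType) (G : network) (B : boarding G)
    (M : demand R B) (c : flow R G) : flow R G :=
  total_flow M (fun d => demand_fun_dest M d c).

Definition ngev_weight (R : realType) (G : network) (B : boarding G)
    (M : demand R B) (c : flow R G) (s : node G -> node G -> \bar R)
    (d : node G) (e : link G) : R :=
  alpha M d e *
  fine (expeR (- ((theta M d (tail e))%:E * ((c e)%:E + s (head e) d))))%E.

(* This is 0 (as 0 / 0 = 0) when no link leaving the tail of e has a route to d. *)
Definition ngev_prob (R : realType) (G : network) (B : boarding G)
    (M : demand R B) (c : flow R G) (s : node G -> node G -> \bar R)
    (d : node G) (e : link G) : R :=
  ngev_weight M c s d e /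
  \sum_(e' | tail e' == tail e) ngev_weight M c s d e'.

(* The expected minimum cost from a node without a route to d is +oo, so that
   the links entering it contribute exp (-oo) = 0; in an acyclic network with
   several destinations such nodes are unavoidable (e.g. another destination
   without outgoing links). *)
Definition ngev_equilibrium (R : realType) (G : network) (B : boarding G)
    (S : link_costs R B) (M : demand R B)
    (c : flow R G) (xhat : node G -> flow R G) (s : node G -> node G -> \bar R) :
    Prop :=
  [/\ forall d, d \in dest M -> demand_feasible M d (xhat d),
      supply_feasible S (total_flow M xhat),
      c = cost_map S (total_flow M xhat) &
      forall d, d \in dest M ->
      [/\ s d d = 0%E,
          forall i, if reaches M d i then s i d \is a fin_num
                    else s i d == +oo%E,
          forall i, i != d -> reaches M d i ->
            (1 = \sum_(e | tail e == i) (alpha M d e)%:E *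
                   expeR (- ((theta M d i)%:E *
                             ((c e)%:E + s (head e) d - s i d))))%E &
          forall i e, i != d -> tail e = i ->
            xhat d e = ngev_prob M c s d e * outflow (xhat d) i]].

Definition nle_c (R : realType) (G : network) (B : boarding G)
    (S : link_costs R B) (M : demand R B) (c : flow R G) : Prop :=
  cost_set S c /\ cost_inv S c = demand_fun M c.

(* Main.v *)
Require Import Defs.
From mathcomp Require Import all_boot all_order all_algebra.
From mathcomp Require Import all_classical all_reals all_analysis.
From mathcomp Require Import ring.

(** Both problems say that every destination's demand is loaded by the same
    logit splits; they differ only in how the splits are produced.

    Fix link costs [c] and a destination [d]. Solving the recursion of the
    expected minimum costs [s] backwards from [d] turns the cost of each link
    ij that carries flow into
      c_ij = s_i - s_j + (ln alpha_ij - ln p_ij) / theta_i,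
    where p_ij are the NGEV probabilities. Inserted in the objective
    [c . y - H_d(y)], the potential differences telescope, by flow
    conservation, to a constant that only depends on the demand, and what
    remains is a weighted Kullback-Leibler divergence between the link
    proportions of [y] and [p] ([objective_divergence]). Gibbs' inequality
    ([link_divergence_ge0]) makes it nonnegative, and zero exactly when [y]
    splits the outflow of each node according to [p]. On an acyclic network a
    feasible flow with given splits exists and is unique
    ([logit_loading_exists], [logit_loading_uniq]), so this flow is the unique
    minimizer [F_d(c)] ([demand_fun_destE]).

    The objective is infinite for a flow on a link of weight 0; for the other
    flows, every link in use leads to a node with a route to [d]
    ([feasible_route]), where [s] is finite. This is what allows real-valued
    computations although [s] is infinite elsewhere.

    On the supply side, the cost map is one-to-one on feasible flows
    ([cost_map_inj]): a non-queue link reveals its flow, and the queue costs of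
    a run-station pair reveal the partial sums of its queue flows. Hence
    [C^-1(c) = F(c)] says that the loaded flows have cost [c]. *)

Set Implicit Arguments.
Unset Strict Implicit.
Unset Printing Implicit Defensive.

Import Order.TTheory GRing.Theory Num.Theory.
Local Open Scope ring_scope.

(* [seq.head] would otherwise shadow the head of a link. *)
Local Notation head := Defs.head.

(** * Recursion along an acyclic network *)

Definition adjacent (G : network) : rel (node G) :=
  [rel i j | [exists e : link G, (tail e == i) && (head e == j)]].

(** A link goes strictly down in height, so that induction and recursion on the
    height run from the destination backwards. *)
Definition height (G : network) (i : node G) : nat :=
  #|[set j | connect (@adjacent G) i j]|.

Lemma adjacent_link (G : network) (e : link G) : adjacent (tail e) (head e).
Proof. by apply/existsP; exists e; rewrite !eqxx. Qed.

Lemma no_return (G : network) (e : link G) :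
  ~~ connect (@adjacent G) (head e) (tail e).
Proof.
apply/negP => /connectP[p p_path p_last].
suff: head e :: p = [::] by [].
apply: (@link_acyclic G); rewrite /= rcons_path p_path -p_last.
exact: adjacent_link.
Qed.

Lemma height_head (G : network) (e : link G) :
  (height (head e) < height (tail e))%N.
Proof.
apply: proper_card; apply/properP; split.
  apply/fintype.subsetP => j; rewrite !inE; apply: connect_trans.
  exact/connect1/adjacent_link.
by exists (tail e); rewrite inE ?connect0 ?(negbTE (no_return e)).
Qed.

(** The height turned upside down: recursion on the depth follows the links
    forwards, from the origins. *)
Definition depth (G : network) (i : node G) : nat := (#|node G| - height i)%N.

Lemma depth_tail (G : network) (e : link G) :
  (depth (tail e) < depth (head e))%N.
Proof.
apply: ltn_sub2l (height_head e).
by apply: leq_trans (height_head e) (max_card _).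
Qed.

(** Well-founded recursion for a functional given as a whole: the iterates of
    [Phi] are stationary at [i] from the [(r i).+1]-st on, whatever [f0] is. *)
Lemma measure_fixpoint (I T : Type) (r : I -> nat)
    (Phi : (I -> T) -> I -> T) (f0 : I -> T) :
  (forall f g i, (forall j, (r j < r i)%N -> f j = g j) ->
     Phi f i = Phi g i) ->
  exists f, forall i, f i = Phi f i.
Proof.
move=> PhiE.
have stable n m i : (r i < n)%N -> (r i < m)%N ->
    iter n Phi f0 i = iter m Phi f0 i.
  elim: n m i => // n IHn [//|m] i; rewrite !ltnS => rn rm /=.
  by apply: PhiE => j rji; apply: IHn; apply: leq_trans rji _.
exists (fun i => iter (r i).+1 Phi f0 i) => i /=.
by apply: PhiE => j rji; exact: (stable (r i) (r j).+1).
Qed.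

(** * The cost map is one-to-one *)

Lemma cost_map_inj (R : realType) (G : network) (B : boarding G)
    (S : link_costs R B) :
  {in supply_feasible S &, injective (cost_map S)}.
Proof.
move=> x y; rewrite !inE => -[x0 xfin] [y0 yfin] exy.
have costE e : cost S x e = cost S y e.
  by rewrite -(fineK (xfin e)) -(fineK (yfin e)) -/(cost_map S x e) exy.
have ownE e : kind e <> BoardingQueue -> x e = y e.
  move=> eNQ; have := costE e; rewrite !cost_own// => -[].
  apply: (inc_inj_in (le_mono_in (@own_cost_increasing _ _ _ S _ eNQ)));
    by rewrite in_itv/= andbT.
(* The argument of the [l]-th queue cost. It is below the capacity at a feasible
   flow, where the queue cost is strictly increasing. *)
pose load (z : flow R G) p l : R :=
  z (onboard (b := B) p 0) + \sum_(1 <= k < l.+1) z (queue (b := B) p k).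
have loadE p l : p \in run_station B -> (0 < l <= nqueue B)%N ->
    load x p l = load y p l.
  move=> pB lB.
  have load0 z : (forall e, 0 <= z e) -> 0 <= load z p l.
    by move=> z0; rewrite addr_ge0// sumr_ge0.
  have loadC z : (forall e, 0 <= z e) ->
      (forall e, cost S z e \is a fin_num) -> load z p l < capacity S p.1.
    move=> z0 zfin; rewrite ltNge; apply/negP => over.
    have := zfin (queue p l); rewrite cost_queue// -/(load z p l).
    by rewrite queue_cost_pinfty.
  have := costE (queue p l); rewrite !cost_queue// -!/(load _ p l).
  apply: (inc_inj_in (le_mono_in (@queue_cost_increasing _ _ _ S p.1 _ lB)));
    by rewrite in_itv/= load0// loadC.
apply/funext => e.
have [|] := pselect (kind e = BoardingQueue); last exact: ownE.
move=> /(queueP B)[p [l [pB lB ->]]].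
have entryE : x (onboard (b := B) p 0) = y (onboard (b := B) p 0).
  by apply: ownE; case: (entry_kind pB) => ->.
have sumE k : (k <= nqueue B)%N ->
    \sum_(1 <= j < k.+1) x (queue (b := B) p j)
    = \sum_(1 <= j < k.+1) y (queue (b := B) p j).
  case: k => [_|k kB]; first by rewrite !big_geq.
  apply: (@addrI _ (x (onboard (b := B) p 0))); rewrite [in RHS]entryE.
  exact: loadE.
(* The flow of one queue link is the difference of two consecutive loads. *)
case: l lB => // l lB.
apply: (@addrI _ (\sum_(1 <= j < l.+1) x (queue (b := B) p j))).
rewrite [in RHS]sumE ?(ltnW lB)// -!(big_nat_recr l.+1 1)//=.
exact: sumE.
Qed.

(** * Routes and feasible flows *)
Lemma has_route_link (R : realType) (G : network) (w : link G -> R) e d :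
  0 < w e -> has_route w (head e) d -> has_route w (tail e) d.
Proof.
move=> we; apply: connect_trans; apply: connect1.
by apply/existsP; exists e; rewrite !eqxx.
Qed.

Lemma has_route_step (R : realType) (G : network) (w : link G -> R) i d :
  i != d -> has_route w i d ->
  exists e, [/\ tail e = i, 0 < w e & has_route w (head e) d].
Proof.
move=> iNd /connectP[[|j p] /=].
  by move=> _ /esym/eqP; rewrite (negbTE iNd).
move=> /andP[/existsP[e /and3P[/eqP ei /eqP ej we]] jp pd].
by exists e; rewrite ei ej; split => //; apply/connectP; exists p.
Qed.

Lemma has_route_sub (R : realType) (G : network) (w w' : link G -> R) i d :
  (forall e, 0 < w e -> 0 < w' e) -> has_route w i d -> has_route w' i d.
Proof.
move=> ww'; apply: connect_sub => j k /existsP[e /and3P[ej ek we]].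
by apply/connect1/existsP; exists e; rewrite ej ek ww'.
Qed.

Lemma has_route_dest (R : realType) (G : network) (w : link G -> R) e :
  ~~ has_route w (head e) (tail e).
Proof.
apply: contra (no_return e); apply: connect_sub => j k /existsP[e'].
by move=> /and3P[/eqP <- /eqP <- _]; apply/connect1/adjacent_link.
Qed.

Lemma od_demand_ge0 (R : realType) (G : network) (B : boarding G)
    (M : demand R B) d i : 0 <= od_demand M d i.
Proof.
have [/od_demand_gt0/ltW//|/od_demand_eq0->//] := boolP ((i, d) \in od M).
Qed.

Lemma le_outflow (R : realType) (G : network) (x : flow R G) e :
  (forall e, 0 <= x e) -> x e <= outflow x (tail e).
Proof. by move=> x0; rewrite /outflow (bigD1 e)//= lerDl sumr_ge0. Qed.

Lemma le_inflow (R : realType) (G : network) (x : flow R G) e :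
  (forall e, 0 <= x e) -> x e <= inflow x (head e).
Proof. by move=> x0; rewrite /inflow (bigD1 e)//= lerDl sumr_ge0. Qed.

Lemma outflow_gt0 (R : realType) (G : network) (x : flow R G) i :
  0 < outflow x i -> exists2 e, tail e = i & 0 < x e.
Proof.
move=> xi; apply: contrapT => noe; have : outflow x i <= 0.
  apply: sumr_le0 => e /eqP ei; rewrite leNgt; apply/negP => xe.
  by apply: noe; exists e.
by rewrite leNgt xi.
Qed.

(** Flow that enters a node other than [d] must leave it, so that in an acyclic
    network it can only end at [d]. *)
Lemma feasible_route (R : realType) (G : network) (B : boarding G)
    (M : demand R B) d (x : flow R G) e :
  demand_feasible M d x -> 0 < x e -> has_route x (head e) d.
Proof.
move=> [x0 xcons]; have [n] := ubnP (height (head e)).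
elim: n e => // n IHn e; rewrite ltnS => en xe.
have [->|jNd] := eqVneq (head e) d; first exact: connect0.
have [] := @outflow_gt0 _ _ x (head e).
  have -> : outflow x (head e) = od_demand M d (head e) + inflow x (head e).
    by rewrite -xcons// subrK.
  by rewrite ltr_wpDl ?od_demand_ge0//; apply: lt_le_trans xe (le_inflow _ _).
move=> e' e'j xe'; rewrite -e'j; apply: has_route_link (xe') (IHn _ _ xe').
by apply: leq_trans en; rewrite -e'j height_head.
Qed.

Lemma feasible_dest (R : realType) (G : network) (B : boarding G)
    (M : demand R B) d (x : flow R G) e :
  demand_feasible M d x -> tail e = d -> x e = 0.
Proof.
move=> xd ed; apply/eqP; rewrite eq_le xd.1 andbT leNgt; apply/negP => xe.
by have := feasible_route xd xe; rewrite -ed (negbTE (has_route_dest _ _)).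
Qed.

(** Summation by parts: a potential difference along the links is paid at the
    nodes, through the divergence of the flow. *)
Lemma sum_potential (R : realType) (G : network) (x : flow R G)
    (s : node G -> R) :
  \sum_e x e * (s (tail e) - s (head e))
  = \sum_i s i * (outflow x i - inflow x i).
Proof.
under eq_bigr do rewrite mulrBr; under [RHS]eq_bigr do rewrite mulrBr.
rewrite !sumrB; congr (_ - _).
  rewrite (partition_big (@tail G) xpredT)//=; apply: eq_bigr => i _.
  by rewrite mulr_sumr; apply: eq_bigr => e /eqP ->; rewrite mulrC.
rewrite (partition_big (@Defs.head G) xpredT)//=; apply: eq_bigr => i _.
by rewrite mulr_sumr; apply: eq_bigr => e /eqP ->; rewrite mulrC.
Qed.

(** * NGEV probabilities and expected minimum costs *)

(** The conditions that the NGEV equilibrium puts on the expected minimum costs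
    to [d] alone. *)
Definition expected_min_cost (R : realType) (G : network) (B : boarding G)
    (M : demand R B) (c : flow R G) (s : node G -> node G -> \bar R)
    (d : node G) : Prop :=
  [/\ s d d = 0%E,
      forall i, if reaches M d i then s i d \is a fin_num
                else s i d == +oo%E &
      forall i, i != d -> reaches M d i ->
        (1 = \sum_(e | tail e == i) (alpha M d e)%:E *
               expeR (- ((theta M d i)%:E *
                         ((c e)%:E + s (head e) d - s i d))))%E].

Lemma ngev_weight_fin (R : realType) (G : network) (B : boarding G)
    (M : demand R B) (c : flow R G) s d e :
  s (head e) d \is a fin_num ->
  ngev_weight M c s d e =
  alpha M d e * expR (- (theta M d (tail e) * (c e + fine (s (head e) d)))).
Proof. by rewrite /ngev_weight; case: (s _ _). Qed.

Lemma ngev_weight_pinfty (R : realType) (G : network) (B : boarding G)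
    (M : demand R B) (c : flow R G) s d e :
  d \in dest M -> s (head e) d = +oo%E -> ngev_weight M c s d e = 0.
Proof.
move=> dM sy.
by rewrite /ngev_weight sy addey// gt0_muley// ?lte_fin ?theta_gt0//= mulr0.
Qed.

Lemma ngev_weight_ge0 (R : realType) (G : network) (B : boarding G)
    (M : demand R B) (c : flow R G) s d e :
  d \in dest M -> 0 <= ngev_weight M c s d e.
Proof. by move=> dM; rewrite mulr_ge0 ?alpha_ge0// fine_ge0// expeR_ge0. Qed.

(** Factors exp (theta_i s_i) out of the terms of the expected minimum cost
    equation; what is left are the weights that define the probabilities. *)
Lemma ngev_weight_exp (R : realType) (G : network) (B : boarding G)
    (M : demand R B) (c : flow R G) s d e :
  d \in dest M -> s (tail e) d \is a fin_num ->
  s (head e) d \is a fin_num \/ s (head e) d = +oo%E ->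
  ((alpha M d e)%:E * expeR (- ((theta M d (tail e))%:E *
      ((c e)%:E + s (head e) d - s (tail e) d))))%E
  = (ngev_weight M c s d e *
     expR (theta M d (tail e) * fine (s (tail e) d)))%:E.
Proof.
move=> dM; case: (s (tail e) d) => // si _ [|sy].
  move=> sfin; rewrite ngev_weight_fin//.
  case: (s (head e) d) sfin => // sj _ /=.
  by rewrite -EFinM -mulrA -expRD; do 3 f_equal; ring.
rewrite ngev_weight_pinfty// mul0r sy addey// gt0_muley ?lte_fin ?theta_gt0//=.
by rewrite mule0.
Qed.

Section Prob.
Context (R : realType) (G : network) (B : boarding G) (M : demand R B).
Context (c : flow R G) (s : node G -> node G -> \bar R) (d : node G).
Context (dM : d \in dest M) (sP : expected_min_cost M c s d).

Let p := ngev_prob M c s d.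
Let sR i := fine (s i d).

Lemma ngev_weight_sum i : i != d -> reaches M d i ->
  \sum_(e | tail e == i) ngev_weight M c s d e = expR (- (theta M d i * sR i)).
Proof.
move=> iNd ir; have [_ sfin s1] := sP; have := s1 _ iNd ir.
have si : s i d \is a fin_num by have := sfin i; rewrite ir.
rewrite (eq_bigr (fun e =>
  (ngev_weight M c s d e * expR (theta M d i * sR i))%:E)); last first.
  move=> e /eqP ei; rewrite -ei ngev_weight_exp// ?ei//.
  by have := sfin (head e); case: ifP => _; [left|move=> /eqP; right].
rewrite sumEFin -mulr_suml => -[] w1.
have E0 := lt0r_neq0 (expR_gt0 (theta M d i * sR i)).
by rewrite expRN -[LHS]mulr1 -[in LHS](mulfV E0) mulrA -w1 mul1r.
Qed.

Lemma ngev_prob_ge0 e : 0 <= p e.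
Proof.
by rewrite /p divr_ge0 ?sumr_ge0// => *; apply: ngev_weight_ge0.
Qed.

Lemma ngev_prob_sum i : i != d -> reaches M d i ->
  \sum_(e | tail e == i) p e = 1.
Proof.
move=> iNd ir.
rewrite (eq_bigr (fun e => ngev_weight M c s d e *
    (\sum_(e' | tail e' == i) ngev_weight M c s d e')^-1)); last first.
  by move=> e /eqP ei; rewrite /p /ngev_prob ei.
by rewrite -mulr_suml ngev_weight_sum// mulfV// gt_eqF// expR_gt0.
Qed.

Lemma ngev_prob_eq0 e : ~~ ((0 < alpha M d e) && reaches M d (head e)) ->
  p e = 0.
Proof.
have [_ sfin _] := sP; have := sfin (head e).
case: ifP => [_ _|_ /eqP]; last first.
  by rewrite /p /ngev_prob => /ngev_weight_pinfty->//; rewrite mul0r.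
rewrite andbT lt_def alpha_ge0// andbT negbK => /eqP a0.
by rewrite /p /ngev_prob /ngev_weight a0 !mul0r.
Qed.

Lemma ngev_probE e : tail e != d -> 0 < alpha M d e -> reaches M d (head e) ->
  p e = expR (- (theta M d (tail e) * (c e + sR (head e) - sR (tail e))))
        * alpha M d e.
Proof.
move=> eNd ae er; have [_ sfin _] := sP; have := sfin (head e).
rewrite er => se; rewrite /p /ngev_prob ngev_weight_sum//; last first.
  exact: has_route_link ae er.
rewrite ngev_weight_fin// -expRN -mulrA -expRD mulrC; congr (expR _ * _).
by rewrite /sR; ring.
Qed.

(** The logit formula solved for the cost of the link, in which the potential
    difference can then be summed by parts. *)
Lemma link_costE e : tail e != d -> 0 < alpha M d e -> reaches M d (head e) ->
  c e = sR (tail e) - sR (head e)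
        + (theta M d (tail e))^-1 * (ln (alpha M d e) - ln (p e)).
Proof.
move=> eNd ae er; rewrite ngev_probE// lnM ?posrE ?expR_gt0// expRK.
have t0 : theta M d (tail e) != 0 by rewrite gt_eqF// theta_gt0.
by rewrite opprD opprK addrCA subrr addr0 mulKf//; ring.
Qed.

Lemma ngev_prob_gt0 e : tail e != d -> 0 < alpha M d e ->
  reaches M d (head e) -> 0 < p e.
Proof. by move=> *; rewrite ngev_probE// mulr_gt0// expR_gt0. Qed.

End Prob.

(** * Gibbs' inequality *)

(** The Kullback-Leibler term of a link with flow [y], outflow [Y] at its tail
    and probability [p]. The correction [y - p * Y] sums to zero over the links
    leaving a node when the probabilities sum to 1, and makes each single term
    nonnegative. *)
Definition link_divergence (R : realType) (y Y p : R) : R :=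
  y * (ln (y / Y) - ln p) - (y - p * Y).

(** For [0 < y], with [v] the logarithm of [p * Y / y], this is
    [1 + v <= expR v], which is strict unless [v = 0]. *)
Lemma link_divergence_ge0 (R : realType) (y Y p : R) :
  0 <= y -> y <= Y -> 0 <= p -> (0 < y -> 0 < p) ->
  0 <= link_divergence y Y p ?= iff (y == p * Y).
Proof.
move=> y0 yY p0 yp; rewrite /link_divergence; have Y0 := le_trans y0 yY.
have [->|yN0] := eqVneq y 0.
  rewrite mul0r !sub0r opprK; split; first exact: mulr_ge0.
  by rewrite eq_sym.
have {}y0 : 0 < y by rewrite lt_def yN0.
have {}Y0 : 0 < Y by apply: lt_le_trans yY.
have {yp}p0 := yp y0.
have u0 : 0 < p * Y / y by rewrite divr_gt0 ?mulr_gt0.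
have -> : ln (y / Y) - ln p = - ln (p * Y / y).
  rewrite -ln_div ?posrE ?divr_gt0// -lnV ?posrE//; congr ln; field.
  by rewrite !gt_eqF.
have -> : y * - ln (p * Y / y) - (y - p * Y)
    = y * (p * Y / y - (1 + ln (p * Y / y))).
  by field; rewrite gt_eqF.
have -> : (y == p * Y) = (ln (p * Y / y) == 0).
  by rewrite ln_eq0// (can2_eq (divfK yN0) (mulfK yN0)) mul1r eq_sym.
set v := ln _; have -> : p * Y / y = expR v by rewrite lnK.
split; first by rewrite mulr_ge0 ?(ltW y0)// subr_ge0 expR_ge1Dx.
rewrite eq_sym mulf_eq0 (gt_eqF y0)/=.
have [->|vN0] := eqVneq v 0; first by rewrite expR0 addr0 subrr eqxx.
by rewrite subr_eq0 gt_eqF// expR_gt1Dx.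
Qed.

(** * The assignment objective *)

Definition supported (R : realType) (G : network) (a y : flow R G) : Prop :=
  forall e, 0 < y e -> 0 < a e.

(** A zero flow absorbs the infinite logarithms; for a positive flow only
    [lne a] can be infinite. *)
Lemma entropy_term (R : realType) (y Y a : R) :
  0 <= y -> y <= Y -> 0 <= a ->
  (y%:E * (lne (y / Y)%:E - lne a%:E))%E =
  if (0 < y) && (a == 0) then +oo%E else (y * (ln (y / Y) - ln a))%:E.
Proof.
move=> y0 yY a0; have [->|yN0] := eqVneq y 0.
  by rewrite mul0e ltxx mul0r.
have {}y0 : 0 < y by rewrite lt_def yN0.
have Y0 : 0 < Y by apply: lt_le_trans yY.
rewrite (lne_EFin (divr_gt0 y0 Y0)) y0 andTb; case: eqP => [->|/eqP aN0].
  by rewrite /lne lexx/= addey// gt0_muley// lte_fin.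
by rewrite lne_EFin// lt_def aN0.
Qed.

Lemma objective_supported (R : realType) (G : network) (B : boarding G)
    (M : demand R B) c d (y : flow R G) :
  d \in dest M -> (forall e, 0 <= y e) -> supported (alpha M d) y ->
  assignment_objective M c d y =
  (\sum_e (c e * y e + (theta M d (tail e))^-1 *
     (y e * (ln (y e / outflow y (tail e)) - ln (alpha M d e)))))%:E.
Proof.
move=> dM y0 ya; rewrite /assignment_objective /entropy oppeK big_split/= EFinD.
congr (_ + _)%E.
rewrite [in RHS](partition_big (@tail G) xpredT)//= -sumEFin.
apply: eq_bigr => i _.
rewrite (eq_bigr (fun e => (y e * (ln (y e / outflow y i) -
                                   ln (alpha M d e)))%:E)); last first.
  move=> e /eqP ei; rewrite entropy_term ?alpha_ge0// -?ei ?le_outflow//.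
  by case: ifP => // /andP[/ya ae /eqP a0]; rewrite a0 ltxx in ae.
rewrite sumEFin -EFinM mulr_sumr; congr EFin.
by apply: eq_bigr => e /eqP ->.
Qed.

Lemma objective_unsupported (R : realType) (G : network) (B : boarding G)
    (M : demand R B) c d (y : flow R G) :
  d \in dest M -> (forall e, 0 <= y e) -> ~ supported (alpha M d) y ->
  assignment_objective M c d y = +oo%E.
Proof.
move=> dM y0 /existsNP[e /not_implyP[ye /negP ae]].
have {}ae : alpha M d e = 0.
  by apply/eqP; move: ae; rewrite lt_def alpha_ge0// andbT negbK.
rewrite /assignment_objective /entropy oppeK.
pose term e := ((y e)%:E * (lne (y e / outflow y (tail e))%:E -
                            lne (alpha M d e)%:E))%E.
have termN e' : term e' != -oo%E.
  by rewrite /term entropy_term ?alpha_ge0 ?le_outflow//; case: ifP.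
have sumN i : (\sum_(e | tail e == i) term e != -oo)%E.
  by apply/eqP => /esum_eqNyP[e' [_ _ /eqP]]; rewrite (negbTE (termN e')).
suff sumE : (\sum_i ((theta M d i)^-1)%:E * \sum_(e | tail e == i) term e
    = +oo)%E.
  transitivity ((\sum_e c e * y e)%:E +
      \sum_i ((theta M d i)^-1)%:E * \sum_(e | tail e == i) term e)%E;
    last by rewrite sumE addey.
  congr (_ + _)%E; apply: eq_bigr => i _; congr (_ * _)%E.
  by apply: eq_bigr => e' /eqP <-.
apply/esum_eqyP => [i _|].
  case: (\sum_(e | tail e == i) term e)%E (sumN i) => //= _.
  by rewrite gt0_muley// lte_fin invr_gt0 theta_gt0.
exists (tail e); split; rewrite ?mem_index_enum//.
have -> : (\sum_(e' | tail e' == tail e) term e' = +oo)%E.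
  apply/esum_eqyP => [//|]; exists e; split; rewrite ?mem_index_enum//.
  by rewrite /term entropy_term ?alpha_ge0 ?le_outflow// ye ae eqxx.
by rewrite gt0_muley// lte_fin invr_gt0 theta_gt0.
Qed.

(** * The logit loading is the unique minimizer *)

Section Assignment.
Context (R : realType) (G : network) (B : boarding G) (M : demand R B).
Context (c : flow R G) (s : node G -> node G -> \bar R) (d : node G).
Context (dM : d \in dest M) (sP : expected_min_cost M c s d).

Let p := ngev_prob M c s d.

Definition logit_loading (x : flow R G) : Prop :=
  forall e, tail e != d -> x e = p e * outflow x (tail e).

Definition divergence (y : flow R G) : R :=
  \sum_e (theta M d (tail e))^-1 *
     link_divergence (y e) (outflow y (tail e)) (p e).

Lemma supported_reaches (y : flow R G) e : demand_feasible M d y ->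
  supported (alpha M d) y -> 0 < y e -> reaches M d (head e).
Proof. by move=> yd ya ye; apply: has_route_sub ya (feasible_route yd ye). Qed.

Lemma supported_tail (y : flow R G) e : demand_feasible M d y -> 0 < y e ->
  tail e != d.
Proof.
by move=> yd ye; apply/eqP => /(feasible_dest yd) y0; rewrite y0 ltxx in ye.
Qed.

(** The corrections in [link_divergence] cancel node by node, because the
    probabilities at each node carrying flow sum to 1. *)
Lemma sum_prob_outflow (y : flow R G) : demand_feasible M d y ->
  supported (alpha M d) y ->
  \sum_e (theta M d (tail e))^-1 * (y e - p e * outflow y (tail e)) = 0.
Proof.
move=> yd ya; rewrite (partition_big (@tail G) xpredT)//= big1// => i _.
rewrite (eq_bigr (fun e => (theta M d i)^-1 * (y e - p e * outflow y i)));
  last by move=> e /eqP ->.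
rewrite -mulr_sumr sumrB -mulr_suml -/(outflow y i).
have [yi|] := ltP 0 (outflow y i); last first.
  have y0 : 0 <= outflow y i by apply: sumr_ge0 => e _; apply: yd.1.
  by move=> yi; rewrite (le_anti (introT andP (conj yi y0))) mulr0 subrr mulr0.
have [e ei ye] := outflow_gt0 yi.
rewrite ngev_prob_sum// ?mul1r ?subrr ?mulr0//.
  by rewrite -ei (supported_tail yd).
by rewrite -ei; apply: has_route_link (ya _ ye) (supported_reaches yd ya ye).
Qed.

(** The expected cost of the demand is a constant, and the excess over it is a
    divergence. *)
Lemma objective_divergence (y : flow R G) : demand_feasible M d y ->
  supported (alpha M d) y ->
  assignment_objective M c d y =
  (\sum_(i | i != d) fine (s i d) * od_demand M d i
   + divergence y)%:E.
Proof.
move=> yd ya; rewrite objective_supported//; last exact: yd.1.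
congr EFin; have <- : \sum_e y e * (fine (s (tail e) d) - fine (s (head e) d))
    = \sum_(i | i != d) fine (s i d) * od_demand M d i.
  rewrite (sum_potential y (fun i => fine (s i d))) (bigD1 d)//=.
  have [-> _ _] := sP; rewrite mul0r add0r.
  by apply: eq_bigr => i iNd; rewrite yd.2.
rewrite -[RHS]addr0 -[X in _ = _ + X](sum_prob_outflow yd ya) -!big_split/=.
apply: eq_bigr => e _; rewrite /link_divergence -addrA -mulrDr subrK.
have [ye|ye] := ltP 0 (y e); last first.
  by rewrite (le_anti (introT andP (conj ye (yd.1 e)))) !(mul0r,mulr0).
rewrite [in LHS](link_costE dM sP (supported_tail yd ye) (ya _ ye)
  (supported_reaches yd ya ye)).
by rewrite -/p; ring.
Qed.

Lemma divergence_ge0 (y : flow R G) : demand_feasible M d y ->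
  supported (alpha M d) y ->
  0 <= divergence y ?= iff [forall e, y e == p e * outflow y (tail e)].
Proof.
move=> yd ya; have sum0 : \sum_(e : link G) 0 = 0 :> R by rewrite big1.
rewrite -[X in X <= _ ?= iff _]sum0 /divergence.
apply: leif_sum => e _; have t0 := theta_gt0 (tail e) dM.
rewrite -(mulr0 (theta M d (tail e))^-1).
rewrite (mono_leif (ler_pM2l _)) ?invr_gt0//.
apply: link_divergence_ge0;
  [exact: yd.1|exact: le_outflow yd.1|exact: ngev_prob_ge0|].
move=> ye; apply: ngev_prob_gt0 => //; [exact: supported_tail yd ye|exact: ya|].
exact: supported_reaches ye.
Qed.

(** Following the links forwards, the inflow of a node is known when its splits
    are applied. *)
Lemma logit_loading_uniq (x y : flow R G) :
  demand_feasible M d x -> demand_feasible M d y ->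
  logit_loading x -> logit_loading y -> x = y.
Proof.
move=> xd yd xp yp; apply/funext => e.
have [n] := ubnP (depth (tail e)).
elim: n e => // n IHn e; rewrite ltnS => en.
have [ed|eNd] := eqVneq (tail e) d.
  by rewrite (feasible_dest xd ed) (feasible_dest yd ed).
rewrite xp// yp//; congr (_ * _).
apply: (@addIr _ (- inflow x (tail e))); rewrite xd.2//.
rewrite (_ : inflow x (tail e) = inflow y (tail e)) ?yd.2//.
apply: eq_bigr => e' /eqP e'e; apply: IHn.
by apply: leq_trans en; rewrite -e'e depth_tail.
Qed.

Lemma logit_loading_supported (x : flow R G) : demand_feasible M d x ->
  logit_loading x -> supported (alpha M d) x.
Proof.
move=> xd xp e xe; apply: contrapT => /negP ae; have := xe.
rewrite xp; last exact: supported_tail xd xe.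
by rewrite /p (ngev_prob_eq0 dM sP) ?mul0r ?ltxx// (negbTE ae).
Qed.

Lemma logit_loading_divergence (x : flow R G) : demand_feasible M d x ->
  logit_loading x -> divergence x = 0.
Proof.
move=> xd xp; have xa := logit_loading_supported xd xp.
apply/esym/eqP; rewrite (divergence_ge0 xd xa); apply/forallP => e.
have [ed|eNd] := eqVneq (tail e) d; last by rewrite xp.
rewrite (feasible_dest xd ed) /outflow big1 ?mulr0// => e' /eqP e'e.
by rewrite (feasible_dest xd)// e'e.
Qed.

Lemma logit_loading_argmin (x : flow R G) : demand_feasible M d x ->
  logit_loading x -> assignment_argmin M c d x.
Proof.
move=> xd xp; split=> // y yd; have xa := logit_loading_supported xd xp.
have [ya|ya] := pselect (supported (alpha M d) y); last first.
  by rewrite (objective_unsupported _ dM yd.1 ya) leey.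
rewrite !objective_divergence// lee_fin lerD2l.
rewrite (logit_loading_divergence xd xp).
exact: (divergence_ge0 yd ya).
Qed.

(** A minimizer has divergence 0, hence is itself a logit loading. *)
Lemma argmin_logit_loading (x y : flow R G) : demand_feasible M d x ->
  logit_loading x -> assignment_argmin M c d y -> y = x.
Proof.
move=> xd xp [yd /(_ _ xd) yx]; apply: logit_loading_uniq => // e _.
have xa := logit_loading_supported xd xp.
have ya : supported (alpha M d) y.
  apply: contrapT => ya; move: yx.
  by rewrite (objective_unsupported _ dM yd.1 ya) objective_divergence.
move: yx; rewrite !objective_divergence// lee_fin lerD2l.
rewrite (logit_loading_divergence xd xp)// => y0.
have : 0 == divergence y by rewrite eq_le y0 (divergence_ge0 yd ya).
by rewrite (divergence_ge0 yd ya) => /forallP/(_ e)/eqP.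
Qed.

End Assignment.

(** * Existence of the expected minimum costs and of the loading *)

(** The equation of the expected minimum costs solved for s_i is a recursion
    from the heads of the links to their tails. A route to [d] supplies the
    positive weight that keeps the logarithm meaningful. *)
Lemma expected_min_cost_exists (R : realType) (G : network) (B : boarding G)
    (M : demand R B) (c : flow R G) d :
  d \in dest M -> exists f, expected_min_cost M c (fun i _ => f i) d.
Proof.
move=> dM; pose W (f : node G -> \bar R) i : R :=
  \sum_(e | tail e == i) ngev_weight M c (fun j _ => f j) d e.
pose Phi (f : node G -> \bar R) i : \bar R :=
  if i == d then 0%E else if reaches M d i
  then (- ((theta M d i)^-1 * ln (W f i)))%:E else +oo%E.
have [f g i fg|f fE] := @measure_fixpoint _ _ (@height G) Phi (fun=> 0%E).
  rewrite /Phi; do 2 case: ifP => // _; congr (- (_ * ln _))%:E.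
  apply: eq_bigr => e /eqP ei; rewrite /ngev_weight fg//.
  by rewrite -ei height_head.
exists f; have fd : f d = 0%E by rewrite fE /Phi eqxx.
have ffin i : if reaches M d i then f i \is a fin_num else f i == +oo%E.
  rewrite fE /Phi; have [->|_] := eqVneq i d; last by case: (reaches M d i).
  by rewrite /reaches /has_route connect0.
split=> // i iNd ir.
have fi : f i \is a fin_num by have := ffin i; rewrite ir.
have W0 : 0 < W f i.
  have [e [ei ae er]] := has_route_step iNd ir.
  rewrite /W (bigD1 e) ?ei//=; apply: ltr_wpDr.
    by apply: sumr_ge0 => *; apply: ngev_weight_ge0.
  rewrite ngev_weight_fin ?mulr_gt0 ?expR_gt0//.
  by have := ffin (head e); rewrite /reaches er.
rewrite (eq_bigr (fun e => (ngev_weight M c (fun j _ => f j) d e *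
    expR (theta M d i * fine (f i)))%:E)); last first.
  move=> e /eqP ei; rewrite -ei.
  rewrite (@ngev_weight_exp _ _ _ _ _ (fun j _ => f j))// ?ei//.
  by have := ffin (head e); case: ifP => _; [left|move=> /eqP; right].
rewrite sumEFin -mulr_suml -/(W f i) [in fine _]fE /Phi (negbTE iNd) ir/=.
by rewrite mulrN mulVKf ?gt_eqF ?theta_gt0// expRN lnK// mulfV// gt_eqF.
Qed.

(** Loads the network forwards. At a node without a route to [d] the
    probabilities do not sum to 1, but no flow arrives there: there is no
    demand, and the links entering it leave [d] or have probability 0. *)
Lemma logit_loading_exists (R : realType) (G : network) (B : boarding G)
    (M : demand R B) (c : flow R G) s d :
  d \in dest M -> expected_min_cost M c s d ->
  exists x, demand_feasible M d x /\ logit_loading M c s d x.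
Proof.
move=> dM sP; pose p := ngev_prob M c s d.
(* The links leaving [d] have arbitrary probabilities and must stay empty. *)
pose Phi (x : flow R G) e : R := if tail e == d then 0
  else p e * (od_demand M d (tail e) + inflow x (tail e)).
have [x y e xy|x xE] :=
    @measure_fixpoint _ _ (fun e : link G => depth (tail e)) Phi (fun=> 0).
  rewrite /Phi; case: ifP => // _; congr (_ * (_ + _)).
  by apply: eq_bigr => e' /eqP e'e; rewrite xy// -e'e depth_tail.
have x0 e : 0 <= x e.
  have [n] := ubnP (depth (tail e)); elim: n e => // n IHn e.
  rewrite ltnS => en.
  rewrite xE /Phi; case: ifP => // _.
  rewrite mulr_ge0 ?ngev_prob_ge0// addr_ge0 ?od_demand_ge0// sumr_ge0//.
  move=> e' /eqP e'e; apply: IHn; apply: leq_trans en.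
  by rewrite -e'e depth_tail.
have xcons i : i != d -> outflow x i = od_demand M d i + inflow x i.
  move=> iNd; rewrite /outflow (eq_bigr (fun e => p e *
      (od_demand M d i + inflow x i))); last first.
    by move=> e /eqP ei; rewrite xE /Phi ei (negbTE iNd).
  rewrite -mulr_suml; have [ir|/negP iNr] := pselect (reaches M d i).
    by rewrite (ngev_prob_sum dM sP)// mul1r.
  have -> : inflow x i = 0.
    apply: big1 => e /eqP ei; rewrite xE /Phi; case: ifP => // _.
    by rewrite /p (ngev_prob_eq0 dM sP) ?mul0r// ei (negbTE iNr) andbF.
  rewrite od_demand_eq0 ?addr0 ?mulr0//.
  by apply: contra iNr => /od_connected.
exists x; split; first by split=> // i /xcons ->; rewrite addrK.
by move=> e eNd; rewrite [LHS]xE /Phi (negbTE eNd) -xcons.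
Qed.

(** * Equivalence *)

Lemma demand_fun_destE (R : realType) (G : network) (B : boarding G)
    (M : demand R B) (c : flow R G) s d x :
  d \in dest M -> expected_min_cost M c s d ->
  demand_feasible M d x -> logit_loading M c s d x ->
  demand_fun_dest M d c = x.
Proof.
move=> dM sP xd xp; apply: (argmin_logit_loading dM sP xd xp).
by apply: xgetPex; exists x; exact: (logit_loading_argmin dM sP xd xp).
Qed.

Lemma demand_funE (R : realType) (G : network) (B : boarding G)
    (M : demand R B) (c : flow R G) s xhat :
  (forall d, d \in dest M -> [/\ expected_min_cost M c s d,
     demand_feasible M d (xhat d) & logit_loading M c s d (xhat d)]) ->
  demand_fun M c = total_flow M xhat.
Proof.
move=> xP; apply/funext => e; apply: eq_bigr => d dM.
by have [sP xd xp] := xP d dM; rewrite (demand_fun_destE dM sP xd xp).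
Qed.

Theorem corollary5p2 (R : realType) (G : network) (B : boarding G)
    (S : link_costs R B) (M : demand R B) (c : flow R G) :
  (exists (xhat : node G -> flow R G) (s : node G -> node G -> \bar R),
      ngev_equilibrium S M c xhat s)
  <-> nle_c S M c.
Proof.
split=> [[xhat [s [xd xY cE xs]]]|[cC cx]].
  rewrite /nle_c (@demand_funE _ _ _ M c s xhat); last first.
    move=> d dM; have [sd sfin s1 xp] := xs d dM.
    by split; [split|exact: xd|move=> e eNd; apply: xp].
  split; first by exists (total_flow M xhat).
  by rewrite cE /cost_inv pinvKV// ?inE//; apply: cost_map_inj.
have /choice[f fP] : forall d, exists f, d \in dest M ->
    expected_min_cost M c (fun i _ => f i) d.
  move=> d; have [/expected_min_cost_exists-/(_ c)[f fP]|dM] :=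
    boolP (d \in dest M); [by exists f|by exists (fun=> 0%E)].
pose s i d := f d i.
have sP d : d \in dest M -> expected_min_cost M c s d by exact: fP.
have /choice[xhat xP] : forall d, exists x, d \in dest M ->
    demand_feasible M d x /\ logit_loading M c s d x.
  move=> d; have [dM|dM] := boolP (d \in dest M); last by exists (fun=> 0).
  by have [x xP] := logit_loading_exists dM (sP _ dM); exists x.
have xE : total_flow M xhat = cost_inv S c.
  rewrite cx; symmetry; apply: (@demand_funE _ _ _ _ _ s) => d dM.
  by have [? ?] := xP d dM; split=> //; apply: sP.
exists xhat, s; split; first by move=> d /xP[].
- rewrite xE /cost_inv; case: cC => x xY <-.
  by rewrite pinvKV ?inE//; apply: cost_map_inj.
- by rewrite xE /cost_inv pinvK// inE.
- move=> d dM; have [sd sfin s1] := sP d dM; split=> // i e iNd ei.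
  by rewrite -ei; apply: (xP d dM).2; rewrite ei.
Qed.
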